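(* Let $N\ge1$ be an integer. (1) For all $x\in[0,1]\setminus\mathbb{Q}$, $\widehat\omega(x,N)$ is $N$-balanced. Furthermore, for every $N\ge2$ there are uncountably many $x\in[0,1]\setminus\mathbb{Q}$ such that $\widehat\omega(x,N)$ is $2$-balanced. (2) For all $x\in[0,1]\setminus\mathbb{Q}$, $\omega(x,N)$ is $N^2$-balanced. Furthermore, for every $N\ge2$ there are uncountably many $x\in[0,1]\setminus\mathbb{Q}$ such that $\omega(x,N)$ is $2N$-balanced.
   Context: Let $N\ge 1$ be an integer and define $T_N:[0,1]\to[0,1]$ by $T_N(x)=\frac{N}{x}-\lfloor\frac{N}{x}\rfloor$ for $x\ne0$ and $T_N(0)=0$. For $x\in[0,1]\setminus\mathbb{Q}$ the (greedy) NCF digits of $x$ are $d_n=\lfloor N/T_N^{n-1}(x)\rfloor\ge N$, $n\ge1$; one writes $x=[0;d_1,d_2,\ldots]_N$. Every integer sequence $(d_n)_{n\geq 1}$ with $d_n\ge N$ occurs for exactly one irrational $x\in[0,1]$. A substitution on $\{0,1\}$ is given by images of the letters (nonempty words) and extends to finite and infinite words by concatenation. For $x=[0;d_1,d_2,\ldots]_N$ irrational let $\sigma_n(0)=0^{d_n}1^N$, $\sigma_n(1)=0$ and $\widehat\sigma_n(0)=0^{d_n}1$, $\widehat\sigma_n(1)=0^N$ for $n\ge1$. The NCF sequence $\omega(x,N)\in\{0,1\}^{\mathbb N}$ is the unique infinite word $\omega$ for which there exist $\omega^{(1)},\omega^{(2)},\ldots\in\{0,1\}^{\mathbb{N}}$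 with $\omega^{(1)}=\omega$ and $\omega^{(n)}=\sigma_n(\omega^{(n+1)})$ for all $n\ge1$. The dual NCF sequence $\widehat\omega(x,N)$ is defined in the same way with $\widehat\sigma_n$ in place of $\sigma_n$. For a finite word $u$, $|u|$ is its length and $|u|_a$ the number of occurrences of the letter $a$ in $u$. A sequence $\nu\in\{0,1\}^{\mathbb{N}}$ is $C$-balanced ($C>0$) if for all finite factors (contiguous subwords) $u,v$ of $\nu$ with $|u|=|v|$ one has $-C\le|u|_a-|v|_a\le C$ for every letter $a$. *)

(* Defs.v *)
(* The letters 0 and 1 are encoded as false and true. *)
From HB Require Import structures.
From mathcomp Require Import all_boot all_order all_algebra.
From mathcomp Require Import all_classical all_reals.

Set Implicit Arguments.
Unset Strict Implicit.
Unset Printing Implicit Defensive.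

Import Order.TTheory GRing.Theory Num.Theory.

Local Open Scope classical_set_scope.
Local Open Scope ring_scope.

Definition unit_irrational {R : realType} : set R := `[0, 1] `\` rational.

Definition ncf_map {R : realType} (N : nat) (x : R) : R :=
  if x == 0 then 0 else N%:R / x - (Num.floor (N%:R / x))%:~R.

(* Meant for n >= 1. The floor is nonnegative for x in [0, 1], so the absolute
   value only casts it to nat. *)
Definition ncf_digit {R : realType} (N : nat) (x : R) (n : nat) : nat :=
  `|Num.floor (N%:R / iter n.-1 (ncf_map N) x)|%N.

Definition word := nat -> bool.

Definition subst_seq (s : bool -> seq bool) (u : seq bool) : seq bool :=
  flatten (map s u).

(* If the images of both letters are nonempty, the image of the prefix of
   length i.+1 of w has length > i, hence determines the letter at position i
   of the image of w. *)
Definition subst (s : bool -> seq bool) (w : word) : word :=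
  fun i => nth false (subst_seq s (mkseq w i.+1)) i.

Definition sigma (N d : nat) (a : bool) : seq bool :=
  if a then [:: false] else nseq d false ++ nseq N true.

Definition dual_sigma (N d : nat) (a : bool) : seq bool :=
  if a then nseq N false else nseq d false ++ [:: true].

Definition desubstitutes (s : nat -> bool -> seq bool) (w : word) : Prop :=
  exists om : nat -> word,
    om 1%N = w /\ forall n, (1 <= n)%N -> om n = subst (s n) (om n.+1).

(* "The unique w such that ..."; existence and uniqueness are
   [ncf_wordP], [ncf_word_unique], [dual_ncf_wordP], [dual_ncf_word_unique]. *)
Definition ncf_word {R : realType} (N : nat) (x : R) : word :=
  get (desubstitutes (fun n => sigma N (ncf_digit N x n))).

Definition dual_ncf_word {R : realType} (N : nat) (x : R) : word :=
  get (desubstitutes (fun n => dual_sigma N (ncf_digit N x n))).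

Definition factor (u : seq bool) (w : word) : Prop :=
  exists i, u = mkseq (fun k => w (i + k)%N) (size u).

Definition balanced (C : nat) (w : word) : Prop :=
  forall u v : seq bool, factor u w -> factor v w -> size u = size v ->
  forall a : bool,
    - C%:Z <= (count_mem a u)%:Z - (count_mem a v)%:Z <= C%:Z.

Section Desubstitution.
Local Open Scope nat_scope.
Variable s : nat -> bool -> seq bool.
Hypothesis s_head : forall n a, 1 <= n -> exists t, s n a = false :: t.
Hypothesis s_size : forall n, 1 <= n -> 1 < size (s n false).

Let s_gt0 n a : 1 <= n -> 0 < size (s n a).
Proof. by move=> /(s_head a)[t ->]. Qed.

Let prefix_subst f (u v : seq bool) :
  prefix u v -> prefix (subst_seq f u) (subst_seq f v).
Proof.
by move=> /prefixP[t ->]; rewrite /subst_seq map_cat flatten_cat prefix_prefix.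
Qed.

Let prefix_nth (u v : seq bool) i :
  prefix u v -> i < size u -> nth false v i = nth false u i.
Proof. by move=> /prefixP[t ->] iu; rewrite nth_cat iu. Qed.

Let prefix_mkseq (w : word) m m' : m <= m' -> prefix (mkseq w m) (mkseq w m').
Proof.
by move=> mm'; rewrite -(subnKC mm') /mkseq iotaD map_cat prefix_prefix.
Qed.

Let size_subst_seq n u : 1 <= n -> size u <= size (subst_seq (s n) u).
Proof.
move=> n1; elim: u => //= a u IH; rewrite /subst_seq /= size_cat -add1n.
by rewrite leq_add// s_gt0.
Qed.

Let nth_subst n (w : word) m i : 1 <= n ->
  i < size (subst_seq (s n) (mkseq w m)) ->
  nth false (subst_seq (s n) (mkseq w m)) i = subst (s n) w i.
Proof.
move=> n1 im; rewrite /subst; case: (leqP m i.+1) => [le|/ltnW le].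
  by rewrite (@prefix_nth (subst_seq (s n) (mkseq w m))) ?prefix_subst ?prefix_mkseq.
rewrite (@prefix_nth (subst_seq (s n) (mkseq w i.+1))) ?prefix_subst ?prefix_mkseq//.
by apply: leq_trans (size_subst_seq _ n1); rewrite size_mkseq.
Qed.

Let u := fix u n k :=
  if k is k'.+1 then subst_seq (s n) (u n.+1 k') else [:: false].

Let u_head n k : 1 <= n -> exists t, u n k = false :: t.
Proof.
elim: k n => [|k IH] n n1; first by exists [::].
have [t ut] := IH n.+1 isT; have [t' st'] := s_head false n1.
by rewrite /= ut /subst_seq /= st' /=; eexists.
Qed.

Let u_size n k : 1 <= n -> k < size (u n k).
Proof.
elim: k n => [//|k IH] n n1 /=.
have := IH n.+1 isT; have [t ->] := u_head k (isT : 1 <= n.+1).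
rewrite /subst_seq /= size_cat => kt.
apply: leq_ltn_trans kt _; rewrite -(add1n (size t)) -(add1n (1 + size t)) addnA.
by rewrite leq_add ?s_size// size_subst_seq.
Qed.

Let u_prefix n k : 1 <= n -> prefix (u n k) (u n k.+1).
Proof.
elim: k n => [|k IH] n n1; last exact/prefix_subst/IH.
by have [t st] := s_head false n1; rewrite /= /subst_seq /= st /= prefix0s.
Qed.

Let u_prefix_le n k k' : 1 <= n -> k <= k' -> prefix (u n k) (u n k').
Proof.
move=> n1 /subnKC <-; elim: (k' - k) => [|j IH]; first by rewrite addn0 prefix_refl.
by rewrite addnS; apply: prefix_trans IH (u_prefix _ n1).
Qed.

Lemma desubstitutes_exists : exists w, desubstitutes s w.
Proof.
pose om n : word := fun i => nth false (u n i) i.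
exists (om 1); exists om; split=> // n n1; apply/funext => i.
have omE j : j < i.+1 -> om n.+1 j = nth false (u n.+1 i) j.
  by move=> ji; rewrite /om (prefix_nth (u_prefix_le _ (ji : j <= i)))// u_size.
have pre : prefix (mkseq (om n.+1) i.+1) (u n.+1 i).
  apply/prefixP; exists (drop i.+1 (u n.+1 i)).
  rewrite -[LHS](cat_take_drop i.+1); congr (_ ++ _).
  have su : i.+1 <= size (u n.+1 i) by exact: u_size.
  apply: (@eq_from_nth _ false); rewrite ?size_mkseq size_takel// => j ji.
  by rewrite nth_take// nth_mkseq// omE.
rewrite /subst -(prefix_nth (prefix_subst (s n) pre)); last first.
  by apply: leq_trans (size_subst_seq _ n1); rewrite size_mkseq.
rewrite -[subst_seq _ _]/(u n i.+1) /om.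
by rewrite (prefix_nth (u_prefix _ n1))// u_size.
Qed.

Lemma desubstitutes_unique w w' :
  desubstitutes s w -> desubstitutes s w' -> w = w'.
Proof.
suff H om : (forall n, 1 <= n -> om n = subst (s n) (om n.+1)) ->
    forall n k, 1 <= n -> u n k = mkseq (om n) (size (u n k)).
  move=> [om [<- /H om1]] [om' [<- /H om1']]; apply/funext => i.
  have iu : i < size (u 1 i) by exact: u_size.
  have := om1 1 i isT; rewrite {1}(om1' 1 i isT) => /(congr1 (nth false ^~ i)).
  by rewrite !nth_mkseq.
move=> omE n k; elim: k n => [|k IH] n n1.
  rewrite /mkseq /= omE// /subst /mkseq /= /subst_seq /=.
  by have [t ->] := s_head (om n.+1 0) n1.
apply: (@eq_from_nth _ false); rewrite ?size_mkseq// => i iu.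
rewrite nth_mkseq// omE//.
have uE := IH n.+1 isT.
move: iu; rewrite -[u n k.+1]/(subst_seq (s n) (u n.+1 k)) uE => iu.
exact: nth_subst.
Qed.

End Desubstitution.

Lemma ncf_map_unit_irrational {R : realType} (N : nat) (x : R) :
  unit_irrational x -> (1 <= N)%N -> unit_irrational (ncf_map N x).
Proof.
move=> [/= /[!in_itv]/= /andP[x0 x1] xQ] N1.
have xn0 : x != 0 by apply: contra_not_neq xQ => ->; exists 0; rewrite ?rmorph0.
rewrite /ncf_map (negbTE xn0); split=> /=.
  rewrite in_itv /= subr_ge0 floor_le /= lerBlDl.
  by apply/ltW; rewrite -[X in _ + X]/(1%:~R) -intrD floorD1_gt.
move=> [q _ qE]; apply: xQ.
exists (N%:R / (q + (Num.floor (N%:R / x))%:~R)) => //.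
rewrite fmorph_div /= rmorphD /= ratr_nat ratr_int qE subrK invf_div mulrCA.
by rewrite divff ?mulr1// pnatr_eq0 -lt0n.
Qed.

Lemma ncf_digit_ge {R : realType} (N : nat) (x : R) (n : nat) :
  unit_irrational x -> (1 <= N)%N -> (N <= ncf_digit N x n)%N.
Proof.
move=> xI N1; rewrite /ncf_digit.
have : unit_irrational (iter n.-1 (ncf_map N) x).
  by elim: n.-1 => //= k IH; apply: ncf_map_unit_irrational.
move: (iter _ _ _) => y [/= /[!in_itv]/= /andP[y0 y1] yQ].
have yn0 : 0 < y.
  by rewrite lt_neqAle y0 andbT; apply: contra_not_neq yQ => <-; exists 0; rewrite ?rmorph0.
have : (N%:Z <= Num.floor (N%:R / y))%R.
  by rewrite floor_ge_int ler_pdivlMr// ler_piMr.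
by case: (Num.floor _).
Qed.

Section WellDefined.
Context {R : realType} (N : nat) (x : R).
Hypotheses (N1 : (1 <= N)%N) (xI : unit_irrational x).

Let s n := sigma N (ncf_digit N x n).
Let s' n := dual_sigma N (ncf_digit N x n).

Let d_gt0 n : (0 < ncf_digit N x n)%N.
Proof. by apply: leq_trans N1 _; apply: ncf_digit_ge. Qed.

Let s_head n a : (1 <= n)%N -> exists t, s n a = false :: t.
Proof.
rewrite /s /sigma => _; case: a; first by exists [::].
by case: ncf_digit (d_gt0 n) => // d _; eexists.
Qed.

Let s_size n : (1 <= n)%N -> (1 < size (s n false))%N.
Proof.
by move=> _; rewrite /s /sigma size_cat !size_nseq -addn1 leq_add.
Qed.

Let s'_head n a : (1 <= n)%N -> exists t, s' n a = false :: t.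
Proof.
rewrite /s' /dual_sigma => _; case: a; first by case: N N1 => // m _; exists (nseq m false).
by case: ncf_digit (d_gt0 n) => // d _; eexists.
Qed.

Let s'_size n : (1 <= n)%N -> (1 < size (s' n false))%N.
Proof.
by move=> _; rewrite /s' /dual_sigma size_cat !size_nseq /= -addn1 leq_add.
Qed.

Lemma ncf_wordP :
  desubstitutes (fun n => sigma N (ncf_digit N x n)) (ncf_word N x).
Proof. exact: getPex (desubstitutes_exists s_head s_size). Qed.

Lemma ncf_word_unique w :
  desubstitutes (fun n => sigma N (ncf_digit N x n)) w -> w = ncf_word N x.
Proof. by move=> /(desubstitutes_unique s_head s_size); apply; exact: ncf_wordP. Qed.

Lemma dual_ncf_wordP :
  desubstitutes (fun n => dual_sigma N (ncf_digit N x n)) (dual_ncf_word N x).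
Proof. exact: getPex (desubstitutes_exists s'_head s'_size). Qed.

Lemma dual_ncf_word_unique w :
  desubstitutes (fun n => dual_sigma N (ncf_digit N x n)) w ->
  w = dual_ncf_word N x.
Proof.
by move=> /(desubstitutes_unique s'_head s'_size); apply; exact: dual_ncf_wordP.
Qed.

End WellDefined.

(* Main.v *)
Require Import Defs.
From mathcomp Require Import all_boot all_order all_algebra zify ring lra.
From mathcomp Require Import all_classical all_reals.

(* Balance of the dual word. Suppose that a factor u has at least C + 1 more
   ones than a factor v of the same length, |u| being minimal. Then u begins and
   ends with 1; extend v by zeros up to the surrounding ones (or the start of
   the word). The dual substitution puts exactly one 1 at the end of the image of
   each 0, so both factors can be desubstituted, and comparing lengths gives
   factors u' and v' of the next word with v' having at least C + 1 more ones
   than u' and u' at least C + 1 more zeros than v', as soon as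
   N C < (C - 1)(d + 1) + 2. Cutting v' to the length of u' contradicts
   minimality. The inequality holds for C = N because d >= N, and for C = 2 when
   d >= 2N.

   The word omega is obtained from its dual by replacing every 1 by 1^N, which
   multiplies the balance constant by at most N.

   Uncountability: the points with all digits >= 2N realise every such digit
   sequence, by nested intervals, so a diagonal argument applies. *)

Set Implicit Arguments.
Unset Strict Implicit.
Unset Printing Implicit Defensive.

Import Order.TTheory GRing.Theory Num.Theory.

Local Open Scope classical_set_scope.

Section Words.
Local Open Scope nat_scope.

(** * Block decomposition of substituted infinite words *)

Lemma subst_seq_cat s u v : subst_seq s (u ++ v) = subst_seq s u ++ subst_seq s v.
Proof. by rewrite /subst_seq map_cat flatten_cat. Qed.

Definition block_start (s : bool -> seq bool) (w : word) (k : nat) : nat :=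
  size (subst_seq s (mkseq w k)).

Lemma block_startS s w k :
  block_start s w k.+1 = block_start s w k + size (s (w k)).
Proof.
by rewrite /block_start mkseqS -cats1 subst_seq_cat size_cat /subst_seq /= cats0.
Qed.

Section NonErasing.
Variable s : bool -> seq bool.
Hypothesis s_gt0 : forall a, 0 < size (s a).

Lemma block_start_ltn w : {homo block_start s w : i j / i < j}.
Proof.
apply: homo_ltn => [|i]; first exact: ltn_trans.
by rewrite block_startS -addn1 leq_add2l.
Qed.

Lemma block_start_leq w i j : (block_start s w i <= block_start s w j) = (i <= j).
Proof. by apply: leq_mono; exact: block_start_ltn. Qed.

Lemma leq_block_start w k : k <= block_start s w k.
Proof.
elim: k => // k IH; have := block_start_ltn w (ltnSn k); lia.
Qed.

Lemma subst_block w k r : r < size (s (w k)) ->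
  subst s w (block_start s w k + r) = nth false (s (w k)) r.
Proof.
move=> rs; rewrite /subst; set p := block_start s w k + r.
have kp : k <= p by rewrite (leq_trans (leq_block_start w k))// leq_addr.
rewrite -(subnKC (kp : k < p.+1)) /mkseq iotaD map_cat -/(mkseq w k.+1).
rewrite mkseqS -cats1 !subst_seq_cat /(subst_seq s [:: w k]) /= cats0 -catA.
rewrite nth_cat ifN; last by rewrite -leqNgt leq_addr.
by rewrite addKn nth_cat rs.
Qed.

Lemma locate_block w p :
  exists k r, r < size (s (w k)) /\ p = block_start s w k + r.
Proof.
elim: p => [|p [k [r [rs ->]]]]; first by exists 0, 0.
have [rs'|sr] := ltnP r.+1 (size (s (w k))); first by exists k, r.+1; rewrite addnS.
by exists k.+1, 0; split=> //; rewrite block_startS; lia.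
Qed.

Lemma mkseq_subst w k :
  mkseq (subst s w) (block_start s w k) = subst_seq s (mkseq w k).
Proof.
elim: k => // k IH; rewrite block_startS /mkseq iotaD map_cat -/(mkseq _ _) IH.
rewrite -/(mkseq w k.+1) mkseqS -cats1 subst_seq_cat; congr (_ ++ _).
rewrite /subst_seq /= cats0; apply: (@eq_from_nth _ false).
  by rewrite size_map size_iota.
move=> r; rewrite size_map size_iota => rs.
by rewrite (nth_map 0) ?size_iota// nth_iota// subst_block.
Qed.

End NonErasing.

(** Comparing prefixes that end at block boundaries reduces this to finite words; such prefixes are
    arbitrarily long because no image is empty. *)
Lemma subst_comp f g w :
  (forall a, 0 < size (f a)) -> (forall a, 0 < size (g a)) ->
  subst f (subst g w) = subst (subst_seq f \o g) w.
Proof.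
move=> f0 g0.
have fg u : subst_seq f (subst_seq g u) = subst_seq (subst_seq f \o g) u.
  by elim: u => // a u IH; rewrite /= /subst_seq /= -/(subst_seq _ _)
    -[flatten (map g u)]/(subst_seq g u) subst_seq_cat IH.
have fg0 a : 0 < size ((subst_seq f \o g) a).
  by rewrite /=; case: (g a) (g0 a) => // b t _; rewrite /subst_seq /= size_cat addn_gt0 f0.
have H k : mkseq (subst f (subst g w)) (block_start (subst_seq f \o g) w k)
         = mkseq (subst (subst_seq f \o g) w) (block_start (subst_seq f \o g) w k).
  rewrite (mkseq_subst fg0) -fg -(mkseq_subst g0) -(mkseq_subst f0); congr mkseq.
  by rewrite /block_start (mkseq_subst g0) fg.
apply/funext => i; have := congr1 (nth false ^~ i) (H i.+1).
by rewrite !nth_mkseq// leq_block_start.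
Qed.

(** * Letter counts of prefixes and balance *)

Definition ones (w : word) (i : nat) : nat := count_mem true (mkseq w i).
Definition zeros (w : word) (i : nat) : nat := count_mem false (mkseq w i).

Lemma onesS w i : ones w i.+1 = ones w i + w i.
Proof. by rewrite /ones mkseqS -cats1 count_cat /= addn0; case: (w i). Qed.

Lemma zerosS w i : zeros w i.+1 = zeros w i + ~~ w i.
Proof. by rewrite /zeros mkseqS -cats1 count_cat /= addn0; case: (w i). Qed.

Lemma zeros_ones w i : zeros w i + ones w i = i.
Proof. by elim: i => // i; rewrite onesS zerosS; case: (w i); lia. Qed.

Lemma ones_monotone w : {homo ones w : i j / i <= j}.
Proof. by apply: homo_leq => [//||i]; [exact: leq_trans | rewrite onesS leq_addr]. Qed.

Lemma zeros_monotone w : {homo zeros w : i j / i <= j}.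
Proof. by apply: homo_leq => [//||i]; [exact: leq_trans | rewrite zerosS leq_addr]. Qed.

(* [n] bounds the length of the factors, for the induction in [dual_excess_lt]. *)
Definition ones_excess_lt (C : nat) (w : word) (n : nat) : Prop :=
  forall i j l, l <= n -> ones w (i + l) + ones w j < ones w i + ones w (j + l) + C.

Lemma count_factor (w : word) i l (a : bool) :
  count_mem a (mkseq (fun k => w (i + k)) l) + count_mem a (mkseq w i)
    = count_mem a (mkseq w (i + l)).
Proof.
have -> : mkseq w (i + l) = mkseq w i ++ mkseq (fun k => w (i + k)) l.
  by rewrite /mkseq iotaD map_cat add0n -{2}(addn0 i) iotaDl -map_comp.
by rewrite count_cat addnC.
Qed.

(** Exchanging the two factors gives the lower bound; at equal lengths an excess of zeros is a
    deficit of ones. *)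
Lemma balancedP C w :
  (forall n, ones_excess_lt C.+1 w n) -> balanced C w.
Proof.
move=> H u v [i uE] [j vE] uv a.
set l := size u in uE uv; rewrite -uv in vE.
have := H l i j l (leqnn l); have := H l j i l (leqnn l).
have := zeros_ones w (i + l); have := zeros_ones w (j + l).
have := zeros_ones w i; have := zeros_ones w j.
have := count_factor w i l a; have := count_factor w j l a.
rewrite -uE -vE {uE vE}; case: a; rewrite -/(ones _ _) -/(zeros _ _) /ones /zeros; lia.
Qed.

(* The factor with more ones can be cut to the length of the other one. *)
Lemma excess_lt_of_zeros C w n i j i' j' : ones_excess_lt C w n ->
  i <= j -> i' <= j' -> j' - i' <= n ->
  zeros w j + zeros w i' + C <= zeros w i + zeros w j' ->
  ones w j + ones w i' < ones w i + ones w j' + C.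
Proof.
move=> H ij ij' ln zC; have := H i i' (j' - i') ln; rewrite (subnKC ij').
have := zeros_ones w j; have := zeros_ones w j'.
have := zeros_ones w i; have := zeros_ones w i'.
(* If the second factor is not longer, the first one cut to its length would have more zeros than
   the whole first factor. Otherwise the first factor is prolonged to that length, which loses no
   ones. *)
have [/[dup] le /(zeros_monotone w)|/ltnW/(ones_monotone w)] := leqP (i + (j' - i')) j.
  by have := zeros_ones w (i + (j' - i')); lia.
by lia.
Qed.

(** * One step of the dual substitution *)

Section DualStep.
Variables (N d : nat) (w' : word).
Hypotheses (N_gt0 : 0 < N) (d_gt0 : 0 < d).

Lemma dual_sigma_gt0 a : 0 < size (dual_sigma N d a).
Proof. by case: a => /=; rewrite ?size_cat ?size_nseq /=; lia. Qed.

Lemma block_start_dual k :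
  block_start (dual_sigma N d) w' k = d.+1 * zeros w' k + N * ones w' k.
Proof.
elim: k => [|k IH]; first by rewrite /zeros /ones /= !muln0.
rewrite block_startS IH zerosS onesS.
by case: (w' k); rewrite /= ?size_cat ?size_nseq /=; lia.
Qed.

Lemma ones_block_start_dual k :
  ones (subst (dual_sigma N d) w') (block_start (dual_sigma N d) w' k) = zeros w' k.
Proof.
rewrite /ones (mkseq_subst dual_sigma_gt0) /zeros.
elim: k => // k IH; rewrite mkseqS -cats1 subst_seq_cat !count_cat IH.
congr addn; rewrite /subst_seq.
by case: (w' k); rewrite /= ?count_cat !count_nseq.
Qed.

Lemma dual_one p : subst (dual_sigma N d) w' p ->
  exists k, w' k = false /\ p = block_start (dual_sigma N d) w' k + d.
Proof.
have [k [r [rs ->]]] := locate_block dual_sigma_gt0 w' p.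
rewrite (subst_block dual_sigma_gt0)//; move: rs; rewrite /dual_sigma.
case E: (w' k); rewrite ?size_cat !size_nseq /=; first by rewrite nth_nseq if_same.
rewrite nth_cat size_nseq addn1 ltnS => rd.
case: ltnP => [lt|]; first by rewrite nth_nseq if_same.
by move=> dr _; exists k; split=> //; lia.
Qed.

Lemma dual_block_end k : w' k = false ->
  subst (dual_sigma N d) w' (block_start (dual_sigma N d) w' k + d).
Proof.
move=> wk; rewrite (subst_block dual_sigma_gt0) wk /= ?size_cat ?size_nseq ?addn1//.
by rewrite nth_cat size_nseq ltnn subnn.
Qed.

Lemma ones_dual_block_end k : w' k = false ->
  ones (subst (dual_sigma N d) w') (block_start (dual_sigma N d) w' k + d) = zeros w' k.
Proof.
move=> wk; have := ones_block_start_dual k.+1.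
rewrite block_startS zerosS wk /= size_cat size_nseq /= addn1 addnS onesS.
by rewrite dual_block_end// !addn1 => -[].
Qed.

Lemma dual_one_ex m : (exists2 k, m <= k & w' k = false) ->
  exists2 p, m <= p & subst (dual_sigma N d) w' p.
Proof.
move=> [k mk wk]; exists (block_start (dual_sigma N d) w' k + d).
  by have := leq_block_start dual_sigma_gt0 w' k; lia.
exact: dual_block_end.
Qed.

(** Every image begins with 0. Together with [dual_one_ex] this yields a 1 beyond any position, up
    to which a factor can be extended. *)
Lemma dual_zero_ex m : exists2 k, m <= k & subst (dual_sigma N d) w' k = false.
Proof.
exists (block_start (dual_sigma N d) w' m).
  exact: leq_block_start dual_sigma_gt0 w' m.
rewrite -[block_start _ _ _]addn0 (subst_block dual_sigma_gt0) ?dual_sigma_gt0//.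
by case: (w' m) => /=; [case: N N_gt0|case: d d_gt0].
Qed.

End DualStep.

(** * Balance of the dual word *)

Lemma extend_left (w : word) c : exists c', [/\ c' <= c, ones w c' = ones w c &
  c' = 0 \/ exists2 p, c' = p.+1 & w p].
Proof.
elim: c => [|c [c' [le eq H]]]; first by exists 0; split=> //; left.
case E: (w c); first by exists c.+1; split=> //; right; exists c.
by exists c'; split; rewrite ?onesS ?E ?addn0// ltnW.
Qed.

Lemma extend_right (w : word) e : (exists2 p, e <= p & w p) ->
  exists e', [/\ e <= e', ones w e' = ones w e & w e'].
Proof.
move=> [p ep wp].
have [k kE] : exists k, p = e + k by exists (p - e); rewrite subnKC.
elim: k e {ep} kE => [|k IH] e kE.
  by exists e; split => //; rewrite -(addn0 e) -kE.
case E: (w e); first by exists e.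
have [|e' [le eq we']] := IH e.+1; first by rewrite kE addnS addSn.
by exists e'; split => //; [exact: ltnW | rewrite eq onesS E addn0].
Qed.

Section DualBalance.
Variables (N K : nat) (d : nat -> nat) (om : nat -> word).
Hypotheses (N_gt0 : 0 < N) (d_gt0 : forall n, 0 < d n).
Hypothesis dK : forall n, N * K.+1 < K * (d n).+1 + 2.
Hypothesis omE : forall n, 1 <= n -> om n = subst (dual_sigma N (d n)) (om n.+1).

(** The balance constant is C = K + 1. The induction on the length bound ranges over all levels [n],
    since the shorter pair of factors lives in the next word. *)
Lemma dual_excess_lt n m : 1 <= n -> ones_excess_lt K.+2 (om n) m.
Proof.
elim: m n => [|m IH] n n1 a c l lm.
  by move: lm; rewrite leqn0 => /eqP ->; rewrite !addn0; lia.
move: lm; rewrite leq_eqVlt ltnS => /predU1P[->|]; last exact: IH.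
rewrite ltnNge; apply/negP => bad.
(* A 0 at either end of the first factor could be dropped, together with the last letter of the
   second, leaving a shorter counterexample. *)
have wa : om n a.
  apply/negPn/negP => wa; have := IH n n1 a.+1 c m (leqnn m).
  have := onesS (om n) a; rewrite (negPf wa).
  have := onesS (om n) (c + m); rewrite -addnS addSnnS; lia.
have wb : om n (a + m).
  apply/negPn/negP => wb; have := IH n n1 a c m (leqnn m).
  have := onesS (om n) (a + m); rewrite (negPf wb).
  have := onesS (om n) (c + m); rewrite -!addnS; lia.
set w' := om n.+1; set s := dual_sigma N (d n).
have s0 : forall x, 0 < size (s x) by exact: dual_sigma_gt0.
have wE : om n = subst s w' by exact: omE.
have [c' [c'c Sc' c'0]] := extend_left (om n) c.
have [e' [ee' Se' we']] : exists e', [/\ c + m.+1 <= e',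
    ones (om n) e' = ones (om n) (c + m.+1) & om n e'].
  apply: extend_right; rewrite wE; apply: dual_one_ex => //.
  by rewrite /w' omE//; exact: dual_zero_ex.
(* Just after a 1, or at the start of the word, a new block begins. *)
have [i2 c'E] : exists i2, c' = block_start s w' i2.
  case: c'0 => [->|[p ->]]; first by exists 0.
  rewrite wE => /(dual_one N_gt0 (d_gt0 n)) [k [wk ->]]; exists k.+1.
  by rewrite block_startS wk /= size_cat size_nseq /= addn1 addnS.
move: wa wb we'; rewrite wE => /(dual_one N_gt0 (d_gt0 n)) [i [wi aE]].
move=> /(dual_one N_gt0 (d_gt0 n)) [j [wj bE]].
move=> /(dual_one N_gt0 (d_gt0 n)) [j2 [wj2 eE]].
rewrite -/s in aE bE eE.
have Sa := ones_dual_block_end N_gt0 (d_gt0 n) wi.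
have Sb := ones_dual_block_end N_gt0 (d_gt0 n) wj.
have Se := ones_dual_block_end N_gt0 (d_gt0 n) wj2.
have Sc := ones_block_start_dual w' N_gt0 (d_gt0 n) i2.
have wb := dual_block_end N_gt0 (d_gt0 n) wj.
rewrite -/s -wE -?c'E -?aE -?bE -?eE in Sa Sb Sc Se wb.
have Sb1 := onesS (om n) (a + m); rewrite wb -addnS Sb /= in Sb1.
have bs := block_start_dual w' N_gt0 (d_gt0 n); rewrite -/s in bs.
(* Ones of [om n] count zeros of [w']: the excess passes to the zeros of u' = [i, j+1) over those of
   v' = [i2, j2). *)
have Zu : zeros w' j2 + zeros w' i + K.+2 <= zeros w' i2 + zeros w' j.+1.
  by rewrite zerosS wj /=; lia.
have ZS := zerosS w' j; rewrite wj /= in ZS.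
have OS := onesS w' j; rewrite wj /= in OS.
have ij : i <= j by rewrite -(block_start_leq s0 w'); lia.
have i2j2 : i2 <= j2.
  rewrite leqNgt; apply/negP; rewrite -(block_start_leq s0 w') block_startS wj2.
  by rewrite /= size_cat size_nseq /=; lia.
have zij := zeros_monotone w' ij; have oij := ones_monotone w' ij.
have zij2 := zeros_monotone w' i2j2; have oij2 := ones_monotone w' i2j2.
have := zeros_ones w' i; have := zeros_ones w' j => zoj zoi.
move: (bs i) (bs j) (bs i2) (bs j2) => bi bj bi2 bj2.
(* Both end letters sit at offset [d n] in their blocks, so [m] is the distance between the starts
   of blocks [i] and [j]. Images of 0 have length at least 2 and [i, j) contains a 0, hence m >= j -
   i + 1. *)
have short : j.+1 - i <= m.
  have z : zeros w' i < zeros w' j by lia.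
  have : m = (d n).+1 * (zeros w' j - zeros w' i) + N * (ones w' j - ones w' i).
    have := leq_mul (leqnn (d n).+1) zij; have := leq_mul (leqnn N) oij.
    by rewrite !mulnBr; lia.
  have := leq_pmull (ones w' j - ones w' i) N_gt0.
  have : 2 * (zeros w' j - zeros w' i) <= (d n).+1 * (zeros w' j - zeros w' i).
    by rewrite leq_mul2r ltnS d_gt0 orbT.
  lia.
(* The extended second factor has length at least m + 1. Written in blocks, this says that N times
   the excess of ones of v' over u' is at least (K + 1)(d + 1) + 1 - d = K (d + 1) + 2, which
   exceeds N (K + 1) by [dK]. *)
have big : ones w' j.+1 + ones w' i2 + K.+2 <= ones w' i + ones w' j2.
  rewrite leqNgt; apply/negP => small.
  have hO : N * (ones w' i + ones w' j2) <= N * (ones w' j + ones w' i2 + K.+1).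
    by rewrite leq_mul2l; lia.
  have hZ : (d n).+1 * (zeros w' j2 + zeros w' i + K.+1) <=
            (d n).+1 * (zeros w' i2 + zeros w' j).
    by rewrite leq_mul2l; lia.
  have := dK n; rewrite !mulnDr in hO hZ; lia.
have := excess_lt_of_zeros (IH n.+1 isT) i2j2 (leqW ij) short.
by rewrite -/w'; lia.
Qed.

End DualBalance.

(** * Passing from the dual word to the word by replacing 1 with 1^N *)

Definition expand (N : nat) (a : bool) : seq bool :=
  if a then nseq N true else [:: false].

Section Expand.
Variable N : nat.
Hypothesis N_gt0 : 0 < N.

Lemma expand_gt0 a : 0 < size (expand N a).
Proof. by case: a; rewrite /= ?size_nseq. Qed.

Lemma count_expand w k :
  zeros (subst (expand N) w) (block_start (expand N) w k) = zeros w k /\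
  ones (subst (expand N) w) (block_start (expand N) w k) = N * ones w k.
Proof.
rewrite /zeros /ones (mkseq_subst expand_gt0).
elim: k => [|k [IH0 IH1]]; first by rewrite muln0.
rewrite mkseqS -cats1 subst_seq_cat !count_cat IH0 IH1 /subst_seq.
by case: (w k); rewrite /= ?count_nseq /=; lia.
Qed.

(** Moving a position inside a run 1^N to either end of the run crosses no zero. This allows factors
    to be grown or shrunk to block boundaries. *)
Lemma expand_round w p : exists k k', [/\ block_start (expand N) w k <= p,
  p <= block_start (expand N) w k',
  zeros w k = zeros (subst (expand N) w) p &
  zeros w k' = zeros (subst (expand N) w) p].
Proof.
have [k [r [rs pE]]] := locate_block expand_gt0 w p.
case E: (w k) rs => /= rs; last first.
  have -> : p = block_start (expand N) w k by lia.
  by exists k, k; have [-> _] := count_expand w k.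
rewrite size_nseq in rs; exists k, k.+1.
have [z0 _] := count_expand w k; have [z1 _] := count_expand w k.+1.
have pk : block_start (expand N) w k <= p by lia.
have pk1 : p <= block_start (expand N) w k.+1.
  by rewrite block_startS E /= size_nseq; lia.
have := zeros_monotone (subst (expand N) w) pk.
have := zeros_monotone (subst (expand N) w) pk1.
have := zerosS w k; rewrite E /=; split=> //; lia.
Qed.

Lemma expand_excess_lt C w :
  (forall n, ones_excess_lt C.+1 w n) ->
  forall n, ones_excess_lt (C * N).+1 (subst (expand N) w) n.
Proof.
move=> H n i j l _; rewrite ltnNge; apply/negP => bad.
(* The factor with too many ones is grown and the other one shrunk, so the excess can only increase
   while the zero counts stay fixed. *)
have [ki [_ [iP _ zi _]]] := expand_round w i.
have [_ [kj [_ jP _ zj]]] := expand_round w (i + l).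
have [_ [ki2 [_ i2P _ zi2]]] := expand_round w j.
have [kj2 [_ [j2P _ zj2 _]]] := expand_round w (j + l).
have [_ oi] := count_expand w ki; have [_ oj] := count_expand w kj.
have [_ oi2] := count_expand w ki2; have [_ oj2] := count_expand w kj2.
have := ones_monotone (subst (expand N) w) iP.
have := ones_monotone (subst (expand N) w) jP.
have := ones_monotone (subst (expand N) w) i2P.
have := ones_monotone (subst (expand N) w) j2P.
rewrite oi oj oi2 oj2 => h1 h2 h3 h4.
have CN : C <= C * N by exact: leq_pmulr.
have Z := zeros_ones (subst (expand N) w).
have := Z i; have := Z j; have := Z (i + l); have := Z (j + l) => z1 z2 z3 z4.
have ij : ki <= kj by rewrite -(block_start_leq expand_gt0 w); lia.
have := zeros_monotone w ij => zij.
(* Shrinking cannot reverse the endpoints, because the second factor contains a zero. *)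
have ij2 : ki2 <= kj2.
  rewrite leqNgt; apply/negP => /ltnW/(zeros_monotone w); lia.
have := excess_lt_of_zeros (H _) ij ij2 (leqnn _).
rewrite zi zj zi2 zj2 => /(_ ltac:(lia)).
rewrite addnS ltnS -(leq_pmul2l N_gt0) !mulnDr; lia.
Qed.

Lemma subst_seq_nseq s a b n : s a = [:: b] -> subst_seq s (nseq n a) = nseq n b.
Proof. by move=> sa; rewrite /subst_seq; elim: n => //= n ->; rewrite sa. Qed.

(** Both composites send 0 to 0^d 1^N and 1 to 0^N. *)
Lemma expand_dual_sigma d w : 0 < d ->
  subst (expand N) (subst (dual_sigma N d) w) = subst (sigma N d) (subst (expand N) w).
Proof.
move=> d_gt0.
have sg a : 0 < size (sigma N d a) by case: a; rewrite //= size_cat !size_nseq addn_gt0 d_gt0.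
rewrite (subst_comp w expand_gt0 (dual_sigma_gt0 N_gt0 d_gt0)).
rewrite (subst_comp w sg expand_gt0); congr subst.
apply/funext => -[] /=; first by rewrite !(@subst_seq_nseq _ _ false).
by rewrite subst_seq_cat (@subst_seq_nseq _ _ false)// /subst_seq /= !cats0.
Qed.

End Expand.

(** * Balance of both words of an irrational point *)

Section NCFWords.
Variables (R : realType) (N : nat) (x : R).
Hypotheses (N_gt0 : 0 < N) (xI : unit_irrational x).

Lemma ncf_digit_gt0 n : 0 < ncf_digit N x n.
Proof. by apply: leq_trans N_gt0 _; exact: ncf_digit_ge. Qed.

(** Expanding every level of the dual desubstitution gives a desubstitution by [sigma]; uniqueness
    concludes. *)
Lemma ncf_word_expand : ncf_word N x = subst (expand N) (dual_ncf_word N x).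
Proof.
have [om [om1 omE]] := dual_ncf_wordP N_gt0 xI.
symmetry; apply: ncf_word_unique => //.
exists (fun n => subst (expand N) (om n)); split=> [|n n1]; first by rewrite om1.
by rewrite omE// expand_dual_sigma// ncf_digit_gt0.
Qed.

Lemma ncf_balanced K :
  (forall n, N * K.+1 < K * (ncf_digit N x n).+1 + 2) ->
  balanced K.+1 (dual_ncf_word N x) /\ balanced (K.+1 * N) (ncf_word N x).
Proof.
move=> dK.
have H n : ones_excess_lt K.+2 (dual_ncf_word N x) n.
  have [om [<- omE]] := dual_ncf_wordP N_gt0 xI.
  exact: dual_excess_lt ncf_digit_gt0 dK omE _ _ _.
split; apply: balancedP => //.
by rewrite ncf_word_expand; exact: expand_excess_lt.
Qed.

End NCFWords.

End Words.

(** * Points with prescribed digits, and uncountability *)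

Section PrescribedDigits.
Local Open Scope ring_scope.
Variables (R : realType) (N : nat).
Hypothesis N_gt0 : (0 < N)%N.

Definition shift (d : nat -> nat) (k : nat) : nat := d k.+1.

(* Endpoints of the closure of the set of [x] with first [m] digits [d 0, ..., d m.-1]. *)
Fixpoint cylinder (d : nat -> nat) (m : nat) : R * R :=
  if m is m'.+1 then
    let c := cylinder (shift d) m' in
    (N%:R / ((d 0%N)%:R + c.2), N%:R / ((d 0%N)%:R + c.1))
  else (0, 1).

Lemma cylinder_ge0 d m : 0 <= (cylinder d m).1 /\ 0 <= (cylinder d m).2.
Proof.
elim: m d => [|m IH] d /=; first by rewrite lexx ler01.
by have [c1 c2] := IH (shift d); rewrite !divr_ge0 ?addr_ge0.
Qed.

(** The map y -> N / (d 0 + y) reverses order, so the inequalities for the two endpoints exchange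
    roles at each step. *)
Lemma cylinder_nested d m : (forall k, (N < d k)%N) ->
  [/\ (cylinder d m).1 <= (cylinder d m).2,
      (cylinder d m).1 <= (cylinder d m.+1).1 &
      (cylinder d m.+1).2 <= (cylinder d m).2].
Proof.
have N0 : 0 < N%:R :> R by rewrite ltr0n.
elim: m d => [|m IH] d dN; have d0 : N%:R < (d 0%N)%:R :> R by rewrite ltr_nat.
  rewrite /= ler01 addr0; split=> //; first by rewrite divr_ge0//; lra.
  by rewrite ler_pdivrMr; lra.
have [c1 c2 c3] := IH (shift d) (fun k => dN k.+1).
have [p1 p2] := cylinder_ge0 (shift d) m.
have [p1' p2'] := cylinder_ge0 (shift d) m.+1.
have E k : cylinder d k.+1 = (N%:R / ((d 0%N)%:R + (cylinder (shift d) k).2),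
    N%:R / ((d 0%N)%:R + (cylinder (shift d) k).1)) by [].
rewrite !{}E; move: (cylinder _ m) (cylinder _ m.+1) => u v in c1 c2 c3 p1 p2 p1' p2' *.
by split; rewrite ler_pM2l// lef_pV2 ?posrE; lra.
Qed.

Definition in_cylinders d (x : R) :=
  forall m, (cylinder d m).1 <= x <= (cylinder d m).2.

Lemma in_cylinders_ex d : (forall k, (N < d k)%N) -> exists x, in_cylinders d x.
Proof.
move=> dN; have cP m := cylinder_nested m dN.
have lo m m' : (m <= m')%N -> (cylinder d m).1 <= (cylinder d m').1.
  apply: (@homo_leq _ (fun k => (cylinder d k).1) (fun x y => x <= y)) => //.
    by move=> y x z; exact: le_trans.
  by move=> k; have [] := cP k.
have hi m m' : (m <= m')%N -> (cylinder d m').2 <= (cylinder d m).2.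
  apply: (@homo_leq _ (fun k => (cylinder d k).2) (fun x y => y <= x)) => //.
    by move=> y x z xy yz; exact: le_trans yz xy.
  by move=> k; have [] := cP k.
have lohi m m' : (cylinder d m).1 <= (cylinder d m').2.
  apply: le_trans (lo _ _ (leq_maxl m m')) _.
  apply: le_trans (hi _ _ (leq_maxr m m')).
  by have [] := cP (maxn m m').
pose E := range (fun m => (cylinder d m).1).
have E0 : E !=set0 by exists (cylinder d 0).1; exists 0%N.
have ubE m : ubound E (cylinder d m).2 by move=> _ [k _ <-].
exists (sup E) => m; rewrite ge_sup// andbT.
by apply: ub_le_sup; [exists (cylinder d 0).2 | exists m].
Qed.

(** The strict bound N < d k keeps points of the cylinders inside the open interval (0, 1). Applied
    to N / x - d 0, this identifies the floor. *)
Lemma in_cylinders_step d x : (forall k, (N < d k)%N) -> in_cylinders d x ->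
  [/\ 0 < x, x < 1, ncf_map N x = N%:R / x - (d 0%N)%:R,
   Num.floor (N%:R / x) = (d 0%N) & in_cylinders (shift d) (ncf_map N x)].
Proof.
have N0 : 0 < N%:R :> R by rewrite ltr0n.
have bnd e y : (forall k, (N < e k)%N) -> in_cylinders e y -> 0 < y < 1.
  move=> eN ey; have e0 : N%:R < (e 0%N)%:R :> R by rewrite ltr_nat.
  have /andP[+ +] := ey 1%N; rewrite /= addr0 => y0 y1; apply/andP; split.
    by apply: lt_le_trans y0; rewrite divr_gt0//; lra.
  by apply: le_lt_trans y1 _; rewrite ltr_pdivrMr; lra.
move=> dN dx; have /andP[x0 x1] := bnd _ _ dN dx.
have d0 : N%:R < (d 0%N)%:R :> R by rewrite ltr_nat.
have sN k : (N < shift d k)%N by exact: dN.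
have dy : in_cylinders (shift d) (N%:R / x - (d 0%N)%:R).
  move=> m; have [c0 c1] := cylinder_ge0 (shift d) m.
  have /andP[] := dx m.+1; rewrite /= => lo hi.
  rewrite lerBrDl lerBlDl; apply/andP; split.
    by move: hi; rewrite !ler_pdivlMr 1?mulrC//; lra.
  by move: lo; rewrite !ler_pdivrMr 1?mulrC//; lra.
have /andP[y0 y1] := bnd _ _ sN dy.
have fl : Num.floor (N%:R / x) = (d 0%N).
  by apply: floor_def; rewrite intrD; lra.
have Tx : ncf_map N x = N%:R / x - (d 0%N)%:R.
  by rewrite /ncf_map gt_eqF// fl.
by rewrite Tx.
Qed.

Lemma in_cylinders_iter d x n : (forall k, (N < d k)%N) -> in_cylinders d x ->
  in_cylinders (fun k => d (n + k)%N) (iter n (ncf_map N) x).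
Proof.
move=> dN dx; elim: n => // n IH.
have [_ _ _ _ H] := in_cylinders_step (fun k => dN (n + k)%N) IH.
suff -> : (fun k => d (n.+1 + k)%N) = shift (fun k => d (n + k)%N) by [].
by apply/funext => k; rewrite /shift addnS.
Qed.

Lemma in_cylinders_digit d x n : (forall k, (N < d k)%N) -> in_cylinders d x ->
  ncf_digit N x n.+1 = d n.
Proof.
move=> dN dx; rewrite /ncf_digit /=.
have [_ _ _ ->] := in_cylinders_step (fun k => dN (n + k)%N) (in_cylinders_iter n dN dx).
by rewrite addn0.
Qed.

(* [ncf_map] sends [p / q] to a fraction with the smaller denominator [p]. *)
Lemma in_cylinders_not_frac d (p q : nat) : (forall k, (N < d k)%N) ->
  ~ in_cylinders d (p%:R / q%:R).
Proof.
elim/ltn_ind: q d p => q IH d p dN dx.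
have [x0 x1 Tx _ dy] := in_cylinders_step dN dx.
(* With the convention 1 / 0 = 0, a zero denominator would give x = 0. *)
have q0 : (0 < q)%N.
  by rewrite lt0n; apply: contraTneq x0 => ->; rewrite invr0 mulr0 ltxx.
have qR : 0 < q%:R :> R by rewrite ltr0n.
have p0 : 0 < p%:R :> R by move: x0; rewrite pmulr_lgt0// invr_gt0.
have pq : (p < q)%N by move: x1; rewrite ltr_pdivrMr// mul1r ltr_nat.
have sN k : (N < shift d k)%N by exact: dN.
have [y0 _ _ _ _] := in_cylinders_step sN dy.
rewrite Tx invf_div in y0 dy.
have yE : N%:R * (q%:R / p%:R) - (d 0%N)%:R = (N * q - d 0 * p)%N%:R / p%:R :> R.
  (* The truncated subtraction is exact because the image of x is positive. *)
  rewrite natrB; last first.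
    rewrite -(ler_nat R) !natrM; move: y0.
    by rewrite subr_gt0 mulrA ltr_pdivlMr// => /ltW.
  by rewrite !natrM; field; rewrite gt_eqF.
by move: dy; rewrite yE; exact: IH.
Qed.

Lemma in_cylinders_irrational d x : (forall k, (N < d k)%N) -> in_cylinders d x ->
  unit_irrational x.
Proof.
move=> dN dx; have [x0 x1 _ _ _] := in_cylinders_step dN dx.
split; first by rewrite /= in_itv /= !ltW.
move=> /rationalP[[a|a] [b xE]]; rewrite xE in x0 dx.
  exact: in_cylinders_not_frac dN dx.
suff : (Negz a)%:~R / b%:R <= 0 :> R by rewrite leNgt x0.
by rewrite NegzE mulrNz mulNr oppr_le0 divr_ge0.
Qed.

Lemma ncf_digits_ex (d : nat -> nat) : (forall k, (N < d k)%N) ->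
  exists2 x : R, unit_irrational x & forall n, ncf_digit N x n.+1 = d n.
Proof.
move=> dN; have [x dx] := in_cylinders_ex dN.
by exists x => [|n]; [exact: in_cylinders_irrational dN dx | exact: in_cylinders_digit].
Qed.

(** Cantor's diagonal argument with digits M and M + 1: digit k + 1 of the new point is chosen to
    differ from that of the point of A numbered k by the injection. *)
Lemma uncountable_large_digits (M : nat) (A : set R) : (N < M)%N ->
  (forall x, unit_irrational x -> (forall n, (M <= ncf_digit N x n.+1)%N) -> A x) ->
  ~ countable A.
Proof.
move=> NM MA /countable_injP[f finj].
pose D k := `[< exists x, [/\ A x, f x = k & ncf_digit N x k.+1 = M] >].
pose d k := (M + D k)%N.
have [x xI xd] := @ncf_digits_ex d (fun k => leq_trans NM (leq_addr _ _)).
have Ax : A x by apply: MA => // n; rewrite xd leq_addr.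
have := xd (f x); rewrite /d /D; case: asboolP => [[y [Ay fxy yd]] /=|H].
  have yx : y = x by apply: finj; rewrite ?inE.
  by rewrite -yx fxy yx in yd *; lia.
by rewrite addn0 => xM; apply: H; exists x.
Qed.

End PrescribedDigits.

Theorem corollary4p5 (R : realType) (N : nat) (hN : (1 <= N)%N) :
  ((forall x : R, unit_irrational x -> balanced N (dual_ncf_word N x)) /\
   ((2 <= N)%N ->
    ~ countable [set x : R | unit_irrational x /\
                             balanced 2 (dual_ncf_word N x)])) /\
  ((forall x : R, unit_irrational x -> balanced (N ^ 2)%N (ncf_word N x)) /\
   ((2 <= N)%N ->
    ~ countable [set x : R | unit_irrational x /\
                             balanced (2 * N)%N (ncf_word N x)])).
Proof.
have all_x (x : R) : unit_irrational x ->
    balanced N (dual_ncf_word N x) /\ balanced (N * N)%N (ncf_word N x).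
  (* Taking K = N - 1, the bound d >= N gives K (d + 1) + 2 >= N^2 + 1. *)
  move=> xI; have := @ncf_balanced R N x hN xI N.-1; rewrite prednK//; apply=> n.
  have := @ncf_digit_ge R N x n xI hN.
  by case: N hN => // K _ /=; nia.
have large (x : R) : unit_irrational x ->
    (forall n, (2 * N <= ncf_digit N x n.+1)%N) ->
    balanced 2 (dual_ncf_word N x) /\ balanced (2 * N)%N (ncf_word N x).
  move=> xI dx; apply: (@ncf_balanced R N x hN xI 1) => n.
  (* For K = 1 the condition reads 2N < d + 3. Index 0 yields the same digit as index 1, the
     predecessor of 0 being 0. *)
  by case: n => [|n]; [have := dx 0%N; rewrite /ncf_digit /=|have := dx n]; lia.
have N2 : (N < 2 * N)%N by lia.
by split; split=> [x /all_x[]|_]; rewrite ?mulnn//;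
  apply: (uncountable_large_digits hN N2) => x xI /(large x xI)[].
Qed.
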